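(* Let $L$ be a completely distributive lattice, let $G$ be a group, and let $\mu \in L(G)$ be a nilpotent $L$-group. Then every maximal $L$-subgroup of $\mu$ having the same tip and tail as $\mu$ is a normal $L$-subgroup of $\mu$.
   Context: $L$ is a completely distributive lattice with order $\le$, join $\vee$, meet $\wedge$, greatest element $1$ and least element $0$; $G$ is a group with identity $e$. An $L$-subset of $G$ is a function $\mu: G\to L$; its tip is $\bigvee_{x\in G}\mu(x)$ and its tail is $\inf\mu=\bigwedge_{x\in G}\mu(x)$. Write $\eta\subseteq\mu$ if $\eta(x)\le\mu(x)$ for all $x\in G$. An $L$-subgroup of $G$ is an $L$-subset $\mu$ with $\mu(xy)\ge\mu(x)\wedge\mu(y)$ and $\mu(x^{-1})=\mu(x)$ for all $x,y\in G$; $L(G)$ is the set of these. For $\mu\in L(G)$, $L(\mu)$ is the set of $\eta\in L(G)$ with $\eta\subseteq\mu$ (the $L$-subgroups of $\mu$). The $L$-subgroup $\langle\eta\rangle$ generated by an $L$-subset $\eta$ is the smallest $L$-subgroup of $G$ containing $\eta$ (the pointwise infimum of all $L$-subgroups containing $\eta$). $\eta\in L(\mu)$ is a normal $L$-subgroup of $\mu$ if $\eta(yxy^{-1})\ge\eta(x)\wedge\mu(y)$ for all $x,y\in G$. $\eta\in L(\mu)$ is a proper $L$-subgroup of $\mu$ if $\eta$ is non-constant and $\eta\ne\mu$. A proper $L$-subgroup $\eta$ of $\mu$ is a maximal $L$-subgroup of $\mu$ if, whenever $\eta\subseteq\theta\subseteq\mu$ with $\theta\in L(\mu)$, either $\theta=\eta$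 or $\theta=\mu$. For $L$-subsets $\eta,\theta\subseteq\mu$, the commutator $(\eta,\theta)$ is the $L$-subset with $(\eta,\theta)(x)=\bigvee\{\eta(y)\wedge\theta(z)\mid y,z\in G,\ x=[y,z]\}$ if $x$ is a commutator $[y,z]=yzy^{-1}z^{-1}$ of elements of $G$, and $(\eta,\theta)(x)=\inf\eta\wedge\inf\theta$ otherwise; $[\eta,\theta]=\langle(\eta,\theta)\rangle$. Put $Z_0(\mu)=\mu$ and $Z_{i+1}(\mu)=[Z_i(\mu),\mu]$. If $\mu$ has tip $a_0$ and tail $t_0$, its trivial $L$-subgroup $\mu_{t_0}^{a_0}$ takes the value $a_0$ at $e$ and $t_0$ at every $x\ne e$. $\mu$ is nilpotent if $a_0\ne t_0$ and $Z_c(\mu)=\mu_{t_0}^{a_0}$ for some non-negative integer $c$. *)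

(* Defs.v *)
From mathcomp Require Import all_boot all_order.
From mathcomp Require Import boolp classical_sets.

Set Implicit Arguments.
Unset Strict Implicit.
Unset Printing Implicit Defensive.

Import Order.TTheory.
Local Open Scope classical_set_scope.

(* [supremum \bot A] and [infimum \top A] return their default on the empty
   set, which is then the correct least upper / greatest lower bound; on other
   sets they are the bound whenever it exists. *)
Definition lsup (d : Order.disp_t) (L : tbLatticeType d) (A : set L) : L :=
  supremum (\bot)%O A.

Definition linf (d : Order.disp_t) (L : tbLatticeType d) (A : set L) : L :=
  infimum (\top)%O A.

Definition complete_lattice (d : Order.disp_t) (L : tbLatticeType d) : Prop :=
  forall A : set L, supremums A !=set0 /\ infimums A !=set0.

(* The f are the choice functions of the family J. *)
Definition completely_distributive (d : Order.disp_t) (L : tbLatticeType d) :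
    Prop :=
  complete_lattice L /\
  forall (I : Type) (J : I -> set L),
    linf [set lsup (J i) | i in [set: I]] =
    lsup [set linf [set f i | i in [set: I]]
         | f in [set f : I -> L | forall i, J i (f i)]].

Section LSubsets.
Variables (d : Order.disp_t) (L : tbLatticeType d) (G : groupType).
Implicit Types (mu eta theta : G -> L).

Definition tip mu : L := lsup (range mu).

Definition tail mu : L := linf (range mu).

Definition Lsubset eta mu : Prop := forall x, (eta x <= mu x)%O.

Definition Lsubgroup mu : Prop :=
  (forall x y, (mu x `&` mu y <= mu (x * y)%g)%O) /\
  (forall x, mu (x^-1)%g = mu x).

Definition Lsubgroup_of mu eta : Prop := Lsubgroup eta /\ Lsubset eta mu.

Definition Lgen eta : G -> L := fun x =>
  linf [set theta x | theta in [set theta | Lsubgroup theta /\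
                                            Lsubset eta theta]].

Definition normal_Lsubgroup mu eta : Prop :=
  Lsubgroup_of mu eta /\
  forall x y, (eta x `&` mu y <= eta (y * x * y^-1)%g)%O.

Definition proper_Lsubgroup mu eta : Prop :=
  [/\ Lsubgroup_of mu eta, ~ (exists a, forall x, eta x = a) & eta <> mu].

Definition maximal_Lsubgroup mu eta : Prop :=
  proper_Lsubgroup mu eta /\
  forall theta, Lsubgroup_of mu theta -> Lsubset eta theta ->
    theta = eta \/ theta = mu.

(* Not MathComp's [~ y, z], which is y^-1 z^-1 y z. *)
Definition gcomm (y z : G) : G := (y * z * y^-1 * z^-1)%g.

Definition Lcommutator_set eta theta : G -> L := fun x =>
  if `[< exists y z, x = gcomm y z >] then
    lsup [set a | exists y z, x = gcomm y z /\ a = (eta y `&` theta z)%O]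
  else (tail eta `&` tail theta)%O.

Definition Lcommutator eta theta : G -> L := Lgen (Lcommutator_set eta theta).

Fixpoint Lcentral mu (i : nat) : G -> L :=
  if i is j.+1 then Lcommutator (Lcentral mu j) mu else mu.

Definition trivial_Lsubgroup mu : G -> L := fun x =>
  if x == 1%g then tip mu else tail mu.

Definition nilpotent_Lgroup mu : Prop :=
  tip mu <> tail mu /\ exists c, Lcentral mu c = trivial_Lsubgroup mu.

End LSubsets.

(* Main.v *)
Require Import Defs.
From mathcomp Require Import all_boot all_order.
From mathcomp Require Import boolp classical_sets.

(** The classical argument for groups is that a proper subgroup H of a nilpotent
    group is strictly smaller than its normalizer: if the term Z_(i+1) = [Z_i, G]
    of the lower central series lies in H, then Z_i normalizes H, because
    y x y^-1 = [y, x] x; so if H were its own normalizer, H would contain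
    the whole series, hence G. When H is maximal its normalizer must therefore
    be G.

    This carries over to L-subgroups once a normalizer is available. The degree
    [Lnormalizer mu eta y] to which y normalizes eta inside mu is the join of
    the degrees a <= mu y such that conjugation by y and by y^-1 maps eta into
    itself up to a. Complete distributivity enters only through the frame law
    [meet_lsup], which makes this join itself such a degree
    ([le_LnormalizerP]). By [Lnormalizer_Lsubgroup] and [Lsubset_Lnormalizer]
    the normalizer lies between eta and mu, so maximality leaves two cases. If
    it is mu, then eta is normal. If it is eta, then [Lcommutator_Lnormalizer]
    pulls the inclusion of the central series in eta down from the trivial
    L-subgroup, which eta contains as it has the tip and tail of mu, to mu
    itself, contradicting that eta is proper. *)

Set Implicit Arguments.
Unset Strict Implicit.
Unset Printing Implicit Defensive.

Import Order.TTheory.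
Local Open Scope classical_set_scope.
Local Open Scope order_scope.

Section CompleteLattice.
Variables (d : Order.disp_t) (L : tbLatticeType d).
Hypothesis completeL : complete_lattice L.
Implicit Types (A : set L) (a b : L).

Lemma lsup_supremums A : supremums A (lsup A).
Proof.
rewrite /lsup /supremum; case: ifPn => [/eqP ->|_].
  by split=> [x []|x _]; rewrite ?le0x.
by have [[s sA] _] := completeL A; apply: xgetPex; exists s.
Qed.

Lemma linf_infimums A : infimums A (linf A).
Proof.
rewrite /linf /infimum; case: ifPn => [/eqP ->|_].
  by split=> [x []|x _]; rewrite ?lex1.
by have [_ [s sA]] := completeL A; apply: xgetPex; exists s.
Qed.

Lemma le_lsup A a : A a -> a <= lsup A.
Proof. by have [ubA _] := lsup_supremums A; apply: ubA. Qed.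

Lemma lsup_le A b : (forall a, A a -> a <= b) -> lsup A <= b.
Proof. by have [_ leastA] := lsup_supremums A => Ab; apply: leastA. Qed.

Lemma linf_le A a : A a -> linf A <= a.
Proof. by have [lbA _] := linf_infimums A; apply: lbA. Qed.

Lemma le_linf A b : (forall a, A a -> b <= a) -> b <= linf A.
Proof. by have [_ greatestA] := linf_infimums A => Ab; apply: greatestA. Qed.

End CompleteLattice.

(** Complete distributivity applied to the two-member family [set b], A: its
    choice functions amount to the elements of A. *)
Lemma meet_lsup (d : Order.disp_t) (L : tbLatticeType d) (A : set L) (b c : L) :
  completely_distributive L ->
  (forall a, A a -> b `&` a <= c) -> b `&` lsup A <= c.
Proof.
move=> [cL distL] Ac.
pose J (i : bool) : set L := if i then [set b] else A.
apply: (@le_trans _ _ (linf [set lsup (J i) | i in [set: bool]])).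
  apply: le_linf => // _ [[] _ <-]; last exact: leIr.
  by apply: le_trans (leIl _ _) _; apply: le_lsup.
rewrite distL; apply: lsup_le => // _ [f fJ <-].
apply: le_trans (Ac _ (fJ false)).
have <- : f true = b by exact: fJ true.
by rewrite lexI; apply/andP; split; apply: linf_le.
Qed.

Section LSubgroups.
Variables (d : Order.disp_t) (L : tbLatticeType d) (G : groupType).
Implicit Types (mu eta theta : G -> L).

Lemma Lsubset_anti mu eta : Lsubset eta mu -> Lsubset mu eta -> eta = mu.
Proof. by move=> le1 le2; apply: funext => x; apply/le_anti; rewrite le1 le2. Qed.

Lemma Lsubgroup_mul eta (a : L) x y : Lsubgroup eta ->
  a <= eta x -> a <= eta y -> a <= eta (x * y)%g.
Proof.
by move=> [etaM _] ax ay; apply: le_trans (etaM x y); rewrite lexI ax ay.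
Qed.

Lemma Lsubgroup_gcomm mu (a : L) x y : Lsubgroup mu ->
  a <= mu x -> a <= mu y -> a <= mu (gcomm x y).
Proof.
by move=> mug ax ay; have [_ muV] := mug; do !apply: Lsubgroup_mul => //;
  rewrite muV.
Qed.

Section Complete.
Hypothesis completeL : complete_lattice L.

Lemma tail_le mu x : tail mu <= mu x.
Proof. by apply: linf_le => //; exists x. Qed.

Lemma Lsubgroup_tip mu : Lsubgroup mu -> tip mu = mu 1%g.
Proof.
move=> mug; apply/le_anti/andP; split; last by apply: le_lsup => //; exists 1%g.
apply: lsup_le => // _ [x _ <-]; rewrite -(mulgV x).
by apply: Lsubgroup_mul => //; case: mug => _ ->.
Qed.

Lemma trivial_Lsubset mu eta : Lsubgroup eta ->
  tip eta = tip mu -> tail eta = tail mu -> Lsubset (trivial_Lsubgroup mu) eta.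
Proof.
move=> etag eq_tip eq_tail x; rewrite /trivial_Lsubgroup.
case: eqP => [->|_]; first by rewrite -eq_tip Lsubgroup_tip.
by rewrite -eq_tail tail_le.
Qed.

Lemma Lsubset_Lgen eta : Lsubset eta (Lgen eta).
Proof. by move=> x; apply: le_linf => // _ [theta [_ le_theta] <-]. Qed.

Lemma Lgen_Lsubset eta theta :
  Lsubgroup theta -> Lsubset eta theta -> Lsubset (Lgen eta) theta.
Proof. by move=> thetag le_theta x; apply: linf_le => //; exists theta. Qed.

Lemma Lgen_Lsubgroup eta : Lsubgroup (Lgen eta).
Proof.
split=> [x y|x].
  apply: le_linf => // _ [theta [thetag le_theta] <-].
  by apply: Lsubgroup_mul => //; [apply: le_trans (leIl _ _) _|
    apply: le_trans (leIr _ _) _]; apply: Lgen_Lsubset.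
by congr linf; apply: eq_imagel => theta [[_ thetaV] _]; rewrite thetaV.
Qed.

Lemma le_Lcommutator eta theta y z :
  eta y `&` theta z <= Lcommutator eta theta (gcomm y z).
Proof.
apply: le_trans (Lsubset_Lgen _ _); rewrite /Lcommutator_set.
case: asboolP => [_|[]]; last by exists y, z.
by apply: le_lsup => //; exists y, z.
Qed.

Lemma Lcommutator_Lsubset mu eta theta : Lsubgroup mu ->
  Lsubset eta mu -> Lsubset theta mu -> Lsubset (Lcommutator eta theta) mu.
Proof.
move=> mug le_eta le_theta; apply: Lgen_Lsubset => // x.
rewrite /Lcommutator_set; case: asboolP => _.
  apply: lsup_le => // _ [y [z [-> ->]]].
  by apply: Lsubgroup_gcomm => //; [apply: le_trans (leIl _ _) _|
    apply: le_trans (leIr _ _) _].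
by apply: le_trans (leIl _ _) _; apply: le_trans (tail_le _ x) _.
Qed.

Lemma Lcentral_Lsubgroup_of mu i :
  Lsubgroup mu -> Lsubgroup_of mu (Lcentral mu i).
Proof.
move=> mug; elim: i => [|i [_ IHi]] /=; first by split=> // x.
by split; [exact: Lgen_Lsubgroup|apply: Lcommutator_Lsubset => // x].
Qed.

End Complete.

(** Bounding both conjugates makes the admissible degrees invariant under
    inversion of y, as an L-subgroup requires. The first bound alone would not
    do: in an infinite group, conjugation by y may map a subgroup properly
    into itself. *)
Definition normalizing_degree mu eta y (a : L) : Prop :=
  a <= mu y /\ forall x, eta x `&` a <= eta (y * x * y^-1)%g /\
                         eta x `&` a <= eta (y^-1 * x * y)%g.

Definition Lnormalizer mu eta : G -> L := fun y =>
  lsup [set a | normalizing_degree mu eta y a].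

Section CompletelyDistributive.
Hypothesis distributiveL : completely_distributive L.

Let completeL : complete_lattice L := distributiveL.1.

(** The join defining the normalizer is attained: meeting with eta x commutes
    with it. Hence the L-subset is handled through its degrees alone. *)
Lemma le_LnormalizerP mu eta y (a : L) :
  a <= Lnormalizer mu eta y <-> normalizing_degree mu eta y a.
Proof.
split=> [le_a|]; last by move=> deg_a; exact: le_lsup.
split=> [|x]; first by apply: le_trans le_a _; apply: lsup_le => // b [].
by split; apply: le_trans (leI2 (lexx _) le_a) _; apply: meet_lsup => // b [_ degb];
  have [] := degb x.
Qed.

Lemma Lnormalizer_Lsubset mu eta : Lsubset (Lnormalizer mu eta) mu.
Proof. by move=> y; have /le_LnormalizerP[] := lexx (Lnormalizer mu eta y). Qed.

Lemma Lnormalizer_Lsubgroup mu eta :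
  Lsubgroup mu -> Lsubgroup (Lnormalizer mu eta).
Proof.
move=> mug; have [_ muV] := mug; split=> [y z|y].
  set a := _ `&` _.
  have /le_LnormalizerP[ay degy] : a <= Lnormalizer mu eta y by exact: leIl.
  have /le_LnormalizerP[az degz] : a <= Lnormalizer mu eta z by exact: leIr.
  apply/le_LnormalizerP; split=> [|x]; first exact: Lsubgroup_mul.
  split.
    have -> : (y * z * x * (y * z)^-1 = y * (z * x * z^-1) * y^-1)%g.
      by rewrite invgM !mulgA.
    apply: le_trans (degy _).1.
    by rewrite lexI (degz x).1 leIr.
  have -> : ((y * z)^-1 * x * (y * z) = z^-1 * (y^-1 * x * y) * z)%g.
    by rewrite invgM !mulgA.
  apply: le_trans (degz _).2.
  by rewrite lexI (degy x).2 leIr.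
congr lsup; apply/seteqP; split=> a [ay deg]; split;
  rewrite ?muV // ?invgK in ay deg *;
  by move=> x; have [? ?] := deg x.
Qed.

Lemma Lsubset_Lnormalizer mu eta :
  Lsubgroup_of mu eta -> Lsubset eta (Lnormalizer mu eta).
Proof.
move=> [etag le_mu] y; have [_ etaV] := etag.
apply/le_LnormalizerP; split=> // x.
by split; do !apply: Lsubgroup_mul => //; rewrite ?etaV ?leIl ?leIr.
Qed.

(** Since y x y^-1 = [y, x] x, the value of eta there is controlled by
    its values at x and at the commutator. *)
Lemma Lcommutator_Lnormalizer mu eta theta :
  Lsubgroup_of mu eta -> Lsubgroup_of mu theta ->
  Lsubset (Lcommutator theta mu) eta -> Lsubset theta (Lnormalizer mu eta).
Proof.
move=> [etag eta_mu] [[_ thetaV] theta_mu] le_eta y.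
have conj_le z x : eta x `&` theta z <= eta (z * x * z^-1)%g.
  have -> : (z * x * z^-1 = gcomm z x * x)%g by rewrite /gcomm mulgVK.
  apply: Lsubgroup_mul => //; last exact: leIl.
  apply: le_trans (le_eta _); apply: le_trans (le_Lcommutator _ _ _ _ _) => //.
  by rewrite meetC; apply: leI2.
apply/le_LnormalizerP; split=> // x; split; first exact: conj_le.
by have := conj_le y^-1%g x; rewrite thetaV invgK.
Qed.

End CompletelyDistributive.

End LSubgroups.

Theorem theorem3p15 (d : Order.disp_t) (L : tbLatticeType d) (G : groupType)
    (mu : G -> L) :
  completely_distributive L ->
  Lsubgroup mu ->
  nilpotent_Lgroup mu ->
  forall eta : G -> L,
    maximal_Lsubgroup mu eta ->
    tip eta = tip mu ->
    tail eta = tail mu ->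
    normal_Lsubgroup mu eta.
Proof.
move=> distL mug [_ [c Zc]] eta [[etamu _ neq_mu] max_eta] eq_tip eq_tail.
have completeL := distL.1; have [etag eta_mu] := etamu.
have [] := max_eta (Lnormalizer mu eta).
- by split; [exact: Lnormalizer_Lsubgroup|exact: Lnormalizer_Lsubset].
- exact: Lsubset_Lnormalizer.
- move=> N_eta; case: neq_mu; apply: Lsubset_anti => //.
  have Zc_eta : Lsubset (Lcentral mu c) eta by rewrite Zc; exact: trivial_Lsubset.
  elim: c Zc_eta {Zc} => // i IHi Zi1_eta; apply: IHi; rewrite -N_eta.
  by apply: Lcommutator_Lnormalizer => //; exact: Lcentral_Lsubgroup_of.
- move=> N_mu; split=> // x y.
  have /(le_LnormalizerP distL)[_ deg] : mu y <= Lnormalizer mu eta y.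
    by rewrite N_mu.
  exact: (deg x).1.
Qed.
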